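(* Let $S$ be a semigroup and let $a\in S$ be Drazin invertible with Drazin inverse $a^D$. Then $a$ is both $1$-naturally invertible and $2$-naturally invertible, and in both cases the natural inverse is $a^{\parallel M}=a^D$ (where $M$ is the greatest element of $\Sigma_1(a)$, respectively of $\Sigma_2(a)$).
   Context: $S$ is a semigroup, $S^1$ is $S$ with an identity adjoined if necessary, $E(S)$ is the set of idempotents. For $A\subseteq S$, $A'=\{x\in S: xa=ax\ \forall a\in A\}$ and $A''=(A')'$. The natural partial order on idempotents is $e\le f\iff ef=fe=e$. Green's preorders: $x\leq_{\mathcal L}y\iff x\in S^1y$; $x\leq_{\mathcal R}y\iff x\in yS^1$; $x\leq_{\mathcal H}y$ iff both hold; $x\,\mathcal H\,y$ iff $x\leq_{\mathcal H}y$ and $y\leq_{\mathcal H}x$. Inverse along an element: $a$ is invertible along $d$ if there is $b\in S$ with $bad=d=dab$ and $b\leq_{\mathcal H}d$; such $b$ is unique and denoted $a^{\parallel d}$. For $e\in E(S)$, $a^{\parallel e}$ exists if and only if $eae\,\mathcal H\,e$. $\Sigma_0(a)=\{e\in E(S): eae\,\mathcal H\,e\}$, $\Sigma_1(a)=\{a\}'\cap\Sigma_0(a)$, $\Sigma_2(a)=\{a\}''\cap\Sigma_0(a)$. For $j\in\{0,1,2\}$, $a$ is $j$-naturally invertible if $\Sigma_j(a)$ has a greatest element $M$ for the natural partial order; then $a^{\parallel M}$ is the $j$-natural inverse of $a$. $a$ is Drazin invertible if there exist $b\in S$ and an integer $n\ge1$ with $ab=ba$, $bab=b$ and $a^{n+1}b=a^n$;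 such $b$ is unique and denoted $a^D$. *)

(* Defs.v *)
From mathcomp Require Import all_boot.
From mathcomp Require Import boolp classical_sets.

Set Implicit Arguments.
Unset Strict Implicit.
Unset Printing Implicit Defensive.

Local Open Scope classical_set_scope.
Local Open Scope group_scope.

Section NaturalInverses.
Variable S : semigroupType.
Implicit Types (a b d e f x y : S) (A : set S) (Sigma : S -> set S).

(* [a ^ n] for [n >= 1]; a semigroup has no [a ^ 0], and the value at [n = 0]
   is the irrelevant [a]. *)
Definition spow a (n : nat) : S := iterop n *%g a a.

Definition idempotents : set S := [set e | e * e = e].

Definition idem_le e f : Prop := e * f = e /\ f * e = e.

Definition commutant A : set S := [set x | forall y, A y -> x * y = y * x].

(* [x \in S^1 y] means that [x = 1 y] or [x = s y] with [s] in [S]; when [S]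
   already has an identity the first case is an instance of the second. *)
Definition leL x y : Prop := x = y \/ exists s, x = s * y.
Definition leR x y : Prop := x = y \/ exists s, x = y * s.
Definition leH x y : Prop := leL x y /\ leR x y.
Definition eqH x y : Prop := leH x y /\ leH y x.

Definition is_inverse_along a d b : Prop :=
  [/\ b * a * d = d, d * a * b = d & leH b d].

Definition Sigma0 a : set S := [set e | idempotents e /\ eqH (e * a * e) e].
Definition Sigma1 a : set S := commutant [set a] `&` Sigma0 a.
Definition Sigma2 a : set S := commutant (commutant [set a]) `&` Sigma0 a.

Definition is_greatest_idem A M : Prop := A M /\ forall e, A e -> idem_le e M.

(* [a] is j-naturally invertible when [Sigma] is [Sigma0], [Sigma1] or
   [Sigma2], for j = 0, 1, 2 respectively. *)
Definition naturally_invertible Sigma a : Prop :=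
  exists M, is_greatest_idem (Sigma a) M.

Definition is_natural_inverse Sigma a b : Prop :=
  exists2 M, is_greatest_idem (Sigma a) M & is_inverse_along a M b.

Definition is_drazin_inverse a b : Prop :=
  exists n : nat, [/\ 0 < n, a * b = b * a, b * a * b = b
                    & spow a n.+1 * b = spow a n].

(* The three relations below are functional, so that each of them is the graph
   of the partial operation it stands for. *)
Lemma is_inverse_along_inj a d b c :
  is_inverse_along a d b -> is_inverse_along a d c -> b = c.
Proof.
move=> [bad _ [bLd _]] [_ dac [_ cRd]].
have -> : b = b * a * c.
  by case: bLd => [->|[s ->]]; rewrite -?mulgA ?(mulgA d) dac.
by case: cRd => [->|[s ->]]; rewrite ?(mulgA _ d) bad.
Qed.

Lemma is_natural_inverse_inj Sigma a b c :
  is_natural_inverse Sigma a b -> is_natural_inverse Sigma a c -> b = c.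
Proof.
move=> [M [MS gM] Mb] [N [NS gN] Nc].
have [_ NM] := gM _ NS; have [MN _] := gN _ MS.
have eMN : M = N by rewrite -MN.
by rewrite -eMN in Nc; apply: is_inverse_along_inj Mb Nc.
Qed.

Let spowS a n : spow a n.+2 = a * spow a n.+1. Proof. by []. Qed.

Let spowC a x n : a * x = x * a -> spow a n.+1 * x = x * spow a n.+1.
Proof.
by move=> ax; elim: n => // n IHn; rewrite spowS -mulgA IHn mulgA ax mulgA.
Qed.

Lemma is_drazin_inverse_inj a b c :
  is_drazin_inverse a b -> is_drazin_inverse a c -> b = c.
Proof.
have step x n k : spow a n.+2 * x = spow a n.+1 ->
    spow a (k + n).+2 * x = spow a (k + n).+1.
  by move=> E; elim: k => // k IHk; rewrite addSn spowS -mulgA IHk.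
have idp x k : a * x = x * a -> x * a * x = x ->
    spow a k.+1 * spow x k.+1 = a * x.
  move=> ax xax; elim: k => // k IHk.
  have xC : x * spow a k.+1 = spow a k.+1 * x by rewrite spowC.
  rewrite (spowS a) (spowS x) -mulgA (mulgA (spow a _)) -xC -mulgA IHk.
  by rewrite (mulgA x) xax.
case=> -[|n] [// _ ab bab En]; case=> -[|m] [// _ ac cac Em].
have {}En := step b n m En.
have {}Em := step c m n Em; rewrite addnC in Em.
set k := (m + n)%N in En Em.
have e1 : a * b = a * c * (a * b).
  rewrite -{1}(idp b k ab bab) -Em spowS -!mulgA (mulgA _ c) spowC // -mulgA.
  by rewrite (idp b k ab bab) mulgA.
have e2 : a * c = a * c * (a * b).
  have sC : spow a k.+1 * spow c k.+1 = spow c k.+1 * spow a k.+1.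
    by apply: spowC; rewrite -spowC.
  rewrite -{1}(idp c k ac cac) sC -En spowS.
  have aP : a * spow a k.+1 = spow a k.+1 * a by rewrite spowC.
  by rewrite aP -(mulgA _ a b) (mulgA (spow c _)) -sC (idp c k ac cac).
have e : a * b = a * c by rewrite e1 -e2.
by rewrite -bab -mulgA e mulgA -ab e ac cac.
Qed.

End NaturalInverses.

(* Main.v *)
(** Put [p = a aD].  Every idempotent [e] of [Sigma1 a] lies in [S a^n] and in
    [a^n S] for all [n >= 1], and [a^n p = a^n = p a^n] for large [n]; hence
    [e p = e = p e].  Applying the factorizations to [e = p] itself gives
    [p x = p x p = x p] for every [x] commuting with [a], so that [p] lies in
    the bicommutant of [a]. *)
Require Import Defs.
From mathcomp Require Import all_boot.
From mathcomp Require Import boolp classical_sets.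

Set Implicit Arguments.
Unset Strict Implicit.
Unset Printing Implicit Defensive.

Local Open Scope classical_set_scope.
Local Open Scope group_scope.

Section DrazinNatural.
Variable S : semigroupType.
Implicit Types a b e x : S.

Lemma spowS a n : spow a n.+2 = a * spow a n.+1. Proof. by []. Qed.

Lemma spow_comm a x n : a * x = x * a -> spow a n.+1 * x = x * spow a n.+1.
Proof.
by move=> ax; elim: n => // n IHn; rewrite spowS -mulgA IHn mulgA ax mulgA.
Qed.

(** As [a] lies in its own commutant, an upper bound of [Sigma1 a] also bounds [Sigma2 a]. *)
Lemma Sigma2_sub_Sigma1 a : Sigma2 a `<=` Sigma1 a.
Proof. by move=> e [Ce Se]; split=> // _ ->; apply: Ce => _ ->. Qed.

(** Commutation turns [e a e] into [e a], so the H-relation yields [e = s a = a r]. Idempotence then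
    gains one power at a time: if [e = t a^k], then [e = e e = s a e = s e a = s t a^(k+1)], and
    dually on the right. *)
Lemma Sigma1_factor_spow a e n : Sigma1 a e ->
  (exists t, e = t * spow a n.+1) /\ (exists u, e = spow a n.+1 * u).
Proof.
move=> [/(_ a erefl) ea [ee [_ [eL eR]]]].
have eae : e * a * e = e * a by rewrite -mulgA -ea mulgA ee.
rewrite eae in eL eR.
have [s es] : exists s, e = s * a.
  by case: eL => [h|[s h]]; [exists e | exists (s * e); rewrite -mulgA].
have [r er] : exists r, e = a * r.
  case: eR => [h|[r h]]; first by exists e; rewrite -ea.
  by exists (e * r); rewrite mulgA -ea.
split.
- elim: n => [|n [t IHn]]; first by exists s.
  exists (s * t).
  by rewrite spowS -spow_comm // -mulgA (mulgA t) -IHn ea mulgA -es ee.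
- elim: n => [|n [u IHn]]; first by exists r.
  exists (u * r).
  by rewrite spowS -mulgA (mulgA _ u) -IHn mulgA -ea -mulgA -er ee.
Qed.

(** With [p = a b], [p a p = a p = p a], and multiplying this by [b] on either side gives back
    [p]. *)
Lemma drazin_idem_Sigma1 a b :
  a * b = b * a -> b * a * b = b -> Sigma1 a (a * b).
Proof.
move=> ab bab.
have pp : a * b * (a * b) = a * b by rewrite -mulgA (mulgA b) bab.
have pa : a * b * a = a * (a * b) by rewrite -mulgA -ab.
have pap : a * b * a * (a * b) = a * (a * b) by rewrite pa -mulgA pp.
split=> [_ ->//|]; split=> //; rewrite pap.
split; split; right.
- by exists a.
- by exists a; rewrite pa.
- by exists b; rewrite mulgA -ab pp.
- by exists b; rewrite -pa -mulgA pp.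
Qed.

Lemma drazin_spow_idem a b n :
  a * b = b * a -> spow a n.+2 * b = spow a n.+1 ->
  spow a n.+1 * (a * b) = spow a n.+1 /\ a * b * spow a n.+1 = spow a n.+1.
Proof.
move=> ab En.
have pr : spow a n.+1 * (a * b) = spow a n.+1 by rewrite mulgA spow_comm.
by split=> //; rewrite -spow_comm // -mulgA -ab.
Qed.

Lemma drazin_idem_bicommutant a b : is_drazin_inverse a b ->
  commutant (commutant [set a]) (a * b).
Proof.
case=> -[|n] [// _ ab bab En] x /(_ a erefl) xa.
have [apr apl] := drazin_spow_idem ab En.
have [[t pt] [u pu]] := Sigma1_factor_spow n (drazin_idem_Sigma1 ab bab).
have ax : spow a n.+1 * x = x * spow a n.+1 by rewrite spow_comm.
(* In [p x = t a^(n+1) x] the power moves to the right of [x], where it absorbs a factor [p]. *)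
have -> : a * b * x = a * b * x * (a * b).
  by rewrite {1 2}pt -!mulgA (mulgA _ x) ax -mulgA apr.
(* Dually, in [x p = x a^(n+1) u] the power moves to the left of [x] and absorbs [p] there, so
   [p x p = x p]. *)
by rewrite -mulgA {2 3}pu (mulgA x) -ax -(mulgA _ x) mulgA apl.
Qed.

Lemma drazin_idem_max a b e : is_drazin_inverse a b ->
  Sigma1 a e -> idem_le e (a * b).
Proof.
case=> -[|n] [// _ ab _ En] Se.
have [apr apl] := drazin_spow_idem ab En.
have [[t et] [u eu]] := Sigma1_factor_spow n Se.
by split; [rewrite et -mulgA apr | rewrite eu mulgA apl].
Qed.

(** The H-bound comes from [b = b (a b) = (a b) b]. *)
Lemma drazin_inverse_along a b : a * b = b * a -> b * a * b = b ->
  is_inverse_along a (a * b) b.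
Proof.
move=> ab bab.
have pp : a * b * (a * b) = a * b by rewrite -mulgA (mulgA b) bab.
split; first by rewrite -ab pp.
  by rewrite -mulgA pp.
by split; right; exists b; [rewrite mulgA bab | rewrite ab bab].
Qed.

End DrazinNatural.

Theorem theorem3p3 (S : semigroupType) (a aD : S)
    (haD : is_drazin_inverse a aD) :
  (naturally_invertible (@Sigma1 S) a /\ is_natural_inverse (@Sigma1 S) a aD)
  /\
  (naturally_invertible (@Sigma2 S) a /\ is_natural_inverse (@Sigma2 S) a aD).
Proof.
have [n [_ ab bab _]] := haD.
have S1p := drazin_idem_Sigma1 ab bab.
have along := drazin_inverse_along ab bab.
have max1 : is_greatest_idem (Sigma1 a) (a * aD)%g.
  by split=> // e; apply: drazin_idem_max.
(* Maximality is inherited from [Sigma1 a]; only membership in the bicommutant is new. *)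
have max2 : is_greatest_idem (Sigma2 a) (a * aD)%g.
  split=> [|e /Sigma2_sub_Sigma1]; last exact: drazin_idem_max.
  by split; [exact: drazin_idem_bicommutant | case: S1p].
by split; split; exists (a * aD)%g.
Qed.
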